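(* For all integers $n\ge 1$ and $k$ with $1\le k\le n$ and $k\ne 1$, $k\neq n$, the $k$-th unique coefficient of row $n$ for $l=3$ is $$g_3(n,k)=\frac{2k(n+1)-2k^2+n(n-1)}{2}.$$
   Context: For positive integers $l\ge 2$ and $n$, consider the expansion of $(x^{n-1}+x^{n-2}+\cdots+x+1)^l$, whose list of coefficients (of $x^0,x^1,\dots,x^{l(n-1)}$) is called a coefficient pattern. The unique coefficient pattern of row $n$ for the power $l$, denoted $U_n(l)$, consists of the coefficients of this pattern that are not already present in the patterns of the preceding (smaller) $n$. The comparison is made by position from either end of the list: the coefficients of $x^j$ with $j\le n-2$, and symmetrically those with $j\ge (l-1)(n-1)+1$, are the ones already present. So $U_n(l)$ is the ordered list of the coefficients of $x^j$ in $(x^{n-1}+\cdots+1)^l$ for $j=n-1,n,\dots,(l-1)(n-1)$. The $k$-th entry of this list, i.e. the coefficient of $x^{n+k-2}$ in $(x^{n-1}+\cdots+1)^l$, is denoted $g_l(n,k)$. For $l=3$ the list $U_n(3)$ has $n$ entries, $k=1,\dots,n$: $U_1(3)=(1)$, $U_2(3)=(3,3)$, $U_3(3)=(6,7,6)$, $U_4(3)=(10,12,12,10)$. *)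

(* Defs.v *)
From mathcomp Require Import all_boot all_order all_algebra.

Set Implicit Arguments.
Unset Strict Implicit.
Unset Printing Implicit Defensive.

Import GRing.Theory.
Local Open Scope ring_scope.

(* (x^(n-1) + ... + x + 1)^l *)
Definition multinomial_poly (l n : nat) : {poly int} :=
  (\sum_(i < n) 'X^i) ^+ l.

Definition coef_pattern (l n : nat) : seq int :=
  mkseq (fun j => (multinomial_poly l n)`_j) (l * n.-1).+1%N.

(* U_n(l): the positions j <= n-2 and j >= (l-1)(n-1)+1 of the pattern, which
   already occur for smaller n, are left out, so j runs over the inclusive
   range n-1, ..., (l-1)(n-1). *)
Definition unique_coef_pattern (l n : nat) : seq int :=
  [seq (coef_pattern l n)`_j | j <- index_iota n.-1 (l.-1 * n.-1).+1%N].

(* g_l(n,k): entries of U_n(l) are numbered from k = 1, hence k.-1; the value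
   is meaningful for 1 <= k <= size (unique_coef_pattern l n). *)
Definition unique_coef (l n k : nat) : int :=
  (unique_coef_pattern l n)`_k.-1.

(* Main.v *)
(* Put P = 1 + x + ... + x^(n-1). The coefficient of x^m in P^2 is m+1 for
   m < n and n-1-t for m = n+t with t < n. The coefficient of x^(n+k-2) in
   P^3 = P * P^2 is the sum of the coefficients of P^2 over the window
   k-1 <= m <= n+k-2 of length n, which splits at m = n into two arithmetic
   progressions. *)
Require Import Defs.
From mathcomp Require Import all_boot all_order all_algebra.
From mathcomp Require Import zify lra.
Import GRing.Theory.
Local Open Scope ring_scope.

Lemma coef_geom (R : nzRingType) (n i : nat) :
  (\sum_(j < n) 'X^j : {poly R})`_i = (i < n)%:R.
Proof.
rewrite (eq_bigr (fun j : 'I_n => 1 *: 'X^j)) => [|j _]; last by rewrite scale1r.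
by rewrite -(poly_def n (fun=> 1)) coef_poly; case: ifP.
Qed.

Lemma coef_geomM (R : nzRingType) (n j : nat) (p : {poly R}) :
  ((\sum_(i < n) 'X^i) * p)`_j = \sum_(i < n) (if (j < i)%N then 0 else p`_(j - i)).
Proof. by rewrite mulr_suml coef_sum; apply: eq_bigr => i _; rewrite coefXnM. Qed.

Lemma coef_geom_sqr_low (R : nzRingType) (n m : nat) : (m < n)%N ->
  ((\sum_(i < n) 'X^i : {poly R}) ^+ 2)`_m = m.+1%:R.
Proof.
move=> mn; rewrite expr2 coefM (eq_bigr (fun=> 1)) => [|i _].
  by rewrite sumr_const card_ord.
have := ltn_ord i => im.
by rewrite !coef_geom !(leq_ltn_trans _ mn) ?mulr1 ?leq_subr.
Qed.

(** The exponents [i] and [n + t - i] are both below [n] exactly when [t < i < n], which leaves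
    [n - t.+1] choices of [i]. *)
Lemma coef_geom_sqr_high (R : nzRingType) (n t : nat) : (t < n)%N ->
  ((\sum_(i < n) 'X^i : {poly R}) ^+ 2)`_(n + t) = (n - t.+1)%:R.
Proof.
move=> tn; rewrite expr2 coef_geomM.
rewrite (eq_bigr (fun i : 'I_n => (t < i)%:R)) => [|i _]; last first.
  have := ltn_ord i => lt_in; rewrite coef_geom ifF; last by lia.
  by congr (_%:R); lia.
rewrite -(big_mkord xpredT (fun i => (t < i)%:R)) (big_cat_nat (n := t.+1)) //=.
rewrite big_nat big1 ?add0r => [|i]; last by case/andP=> _; rewrite ltnS leqNgt => /negbTE->.
rewrite big_nat (eq_bigr (fun=> 1)) => [|i /andP[-> _] //].
by rewrite -big_nat sumr_const_nat.
Qed.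

(** With [n = d + K] and [k = K.+1], the window starts at [K]: its first [d] positions lie below
    [n], the other [K] have the form [n + t]. *)
Lemma coef_geom_cube (R : nzRingType) (d K : nat) : (0 < d)%N ->
  ((\sum_(i < d + K) 'X^i : {poly R}) ^+ 3)`_((d + K).-1 + K) =
  \sum_(i < d) (K + i).+1%:R + \sum_(t < K) (d + K - t.+1)%:R.
Proof.
(* Reversing the index turns position [n - 1 + K - i] into [K + i], so splitting the sum at [i = d]
   cuts the window at [n]. *)
move=> d0; rewrite exprS coef_geomM (reindex_inj rev_ord_inj) /= big_split_ord /=.
congr (_ + _); apply: eq_bigr => i _; have := ltn_ord i => hi.
  rewrite ifF; last by lia.
  by rewrite -(coef_geom_sqr_low _ (d + K)); [congr (_`_ _); lia | lia].
rewrite ifF; last by lia.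
by rewrite -coef_geom_sqr_high; [congr (_`_ _); lia | lia].
Qed.

Lemma sum_succ_shift (K d : nat) :
  (2 * (\sum_(i < d) (K + i).+1) = d * (2 * K + d + 1))%N.
Proof. by elim: d => [|d IH]; rewrite ?big_ord0 // big_ord_recr /= mulnDr IH; nia. Qed.

(** [K <= n] keeps every truncated subtraction exact; the triangular term stands on the left so that
    the right side needs no subtraction. *)
Lemma sum_pred_shift (n K : nat) : (K <= n)%N ->
  (2 * (\sum_(t < K) (n - t.+1)) + K * K.+1 = 2 * (K * n))%N.
Proof.
elim: K => [|K IH] Kn; first by rewrite big_ord0.
by have := IH (ltnW Kn); rewrite big_ord_recr /= mulnDr; nia.
Qed.

Lemma unique_coef3E (n k : nat) : (1 <= k <= n)%N ->
  unique_coef 3 n k = ((multinomial_poly 3 n)`_(n.-1 + k.-1)).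
Proof.
move=> hk; rewrite /unique_coef /unique_coef_pattern.
(* The positions [n - 1, ..., 2(n - 1)] number [n], so [k <= n] keeps [k.-1] inside the list. *)
rewrite (nth_map 0%N) ?size_iota; last by lia.
by rewrite nth_iota; [rewrite nth_mkseq //; lia | lia].
Qed.

Theorem proposition2p3 (n k : nat) (hn : (1 <= n)%N) (hk : (1 <= k <= n)%N)
    (hk1 : k <> 1%N) (hkn : k <> n) :
  (unique_coef 3 n k)%:~R =
    (2%:R * k%:R * (n%:R + 1) - 2%:R * k%:R ^+ 2 + n%:R * (n%:R - 1)) / 2%:R :> rat.
Proof.
rewrite unique_coef3E //.
have [K kE] : exists K, k = K.+1 by exists k.-1; lia.
(* [d.+1 = n - k + 1] counts the window positions below [n]. *)
have [d nE] : exists d, n = (d.+1 + K)%N by exists (n - k)%N; lia.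
rewrite kE nE /multinomial_poly coef_geom_cube // -!natr_sum -natrD rmorph_nat.
apply: (canRL (mulfK _)) => //.
have /(congr1 (fun x => x%:R : rat)) := sum_succ_shift K d.+1.
have /(congr1 (fun x => x%:R : rat)) := sum_pred_shift (d.+1 + K) K (leq_addl _ _).
(* With the two sums opaque, the goal is a linear combination of the two doubled-sum identities. *)
move: (\sum_(t < K) _)%N (\sum_(i < d.+1) _)%N => B A.
rewrite !(natrD, natrM, mulrSr) => hB hA; lra.
Qed.
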